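(* (1) The regular representation of a totally pseudo-unramified finite group is complete. (2) If a finite group admits a complete representation, then it is totally pseudo-unramified. (3) A finite group is totally pseudo-unramified if and only if it admits a complete representation.
   Context: All groups are finite; characters and representations are complex unless stated otherwise. $\mathrm{Irr}(G)$ denotes the set of complex irreducible characters of $G$, and $\langle\cdot,\cdot\rangle$ is the usual scalar product of class functions. Complete representation (recursive definition): a complex linear representation $\pi$ of a finite group $G$ is complete if it decomposes as $\pi=\pi_B\oplus\pi_J$ and there is a nontrivial abelian normal subgroup $N\subseteq G$ such that: (i) $\pi_B|_N$ contains exactly the nontrivial linear (degree one) representations of $N$ as direct summands with multiplicity $1$; (ii) $G=N$, or the representation $$Q\pi=\left[\pi\oplus(\pi_B\otimes\pi_B)\oplus(\pi_B\otimes\pi_J)\oplus(\pi_J\otimes\pi_B)\oplus(\pi_B\otimes\pi\otimes\pi_B)\right]_{N^\tau}$$ is a complete representation of $G/N$. Here, for a representation $\rho$ of $G$, $\rho_{N^\tau}$ denotes the summands of $\rho$ which are trivial on $N$, which naturally give rise to a representation of $G/N$. A real linear representation of a finite group is complete if its complexification is complete. A character is multiplicity free if every irreducible character occurs in it with multiplicity at most $1$. A finite group $G$ is pseudo-unramified over a nontrivial abelian normal subgroup $N$ if for every irreducible character $\mu$ of $N$ there exists $\chi\in\mathrm{Irr}(G)$ with $\langle\chi|_N,\mu\rangle>0$ such that $\chi|_N$ is multiplicity free. A finite group $G$ is totally pseudo-unramified (recursively) if it is abelian or there exists a nontrivial abelian normal subgroup $N$ such that $G$ is pseudo-unramified over $N$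 and $G/N$ is totally pseudo-unramified.
   Formalization: Parts (1) and (3) are stated for nontrivial groups: the trivial group is abelian, hence totally pseudo-unramified, but has no nontrivial abelian normal subgroup and so admits no complete representation. *)

(* Defs.v *)
From mathcomp Require Export all_boot all_order all_algebra all_fingroup all_solvable.
From mathcomp Require Export all_field all_character.

Set Implicit Arguments.
Unset Strict Implicit.
Unset Printing Implicit Defensive.

Export Order.TTheory GroupScope GRing.Theory Num.Theory.

Local Open Scope ring_scope.

(* As in the MathComp character library, "complex" means "over algC".         *)
Notation crepr G := (representation algC G).

Section Representations.

Variables (gT : finGroupType) (G : {group gT}).

Definition regular_rep : crepr G := Representation (regular_repr algC G).

Definition tens_rep (r1 r2 : crepr G) : crepr G :=
  Representation (prod_repr r1 r2).

Variables (N : {group gT}) (nsNG : N <| G) (r : crepr G).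

Definition res_rep : crepr N :=
  Representation (subg_repr r (normal_sub nsNG)).

(* rfix_mx r N, the space of N-fixed vectors, is the largest submodule of r   *)
(* on which N acts trivially (rfix_mx_rstabC), i.e., the sum of all the       *)
(* irreducible summands of r that are trivial on N.                           *)
Let fixN_module : mxmodule r (rfix_mx r N) := normal_rfix_mx_module r nsNG.

Lemma fixN_rker : N \subset rker (submod_repr fixN_module).
Proof. by rewrite rker_submod rfix_mx_rstabC ?normal_sub. Qed.

Definition inv_rep : crepr (G / N) :=
  Representation (quo_repr fixN_rker (normal_norm nsNG)).

End Representations.

Notation "r1 ⊕ r2" := (dadd_grepr r1 r2) (at level 50, left associativity).
Notation "r1 ⊗ r2" := (tens_rep r1 r2) (at level 40, left associativity).

Definition Q_rep (gT : finGroupType) (G N : {group gT}) (nsNG : N <| G)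
    (r rB rJ : crepr G) : crepr (G / N) :=
  inv_rep nsNG (r ⊕ (rB ⊗ rB) ⊕ (rB ⊗ rJ) ⊕ (rJ ⊗ rB) ⊕ (rB ⊗ r ⊗ rB)).

(* 'chi_0 is the trivial character, and 'Chi_i is a representation affording  *)
(* 'chi_i.                                                                    *)
Definition nontriv_linear_sum (gT : finGroupType) (N : {group gT}) : crepr N :=
  \big[@dadd_grepr _ _ _ / @grepr0 _ _ _]_(i : Iirr N
      | ('chi_i \is a linear_char) && (i != 0)) Representation 'Chi_i.

Inductive complete (gT : finGroupType) (G : {group gT}) (r : crepr G) : Prop :=
| Complete (rB rJ : crepr G) (N : {group gT}) (nsNG : N <| G) of
    mx_rsim r (rB ⊕ rJ)
  & N :!=: 1%g
  & abelian N
  & mx_rsim (res_rep nsNG rB) (nontriv_linear_sum N)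
  & G :=: N \/ complete (Q_rep nsNG r rB rJ).

Definition multiplicity_free (gT : finGroupType) (G : {group gT})
    (phi : 'CF(G)) : Prop :=
  forall i : Iirr G, '[phi, 'chi_i] <= 1.

Definition pseudo_unramified (gT : finGroupType) (G N : {group gT}) : Prop :=
  forall j : Iirr N, exists i : Iirr G,
    0 < '['Res[N] 'chi_i, 'chi_j] /\ multiplicity_free ('Res[N] 'chi_i).

Inductive totally_pseudo_unramified (gT : finGroupType) (G : {group gT}) :
  Prop :=
| TpuAbelian of abelian G
| TpuQuotient (N : {group gT}) of
    N <| G
  & N :!=: 1%g
  & abelian N
  & pseudo_unramified G N
  & totally_pseudo_unramified (G / N).

(* Main.v *)
Require Import Defs.

(* Everything is decided by characters. A constituent chi of pi_B whose
   restriction to N contains mu is multiplicity free on N, because pi_B is; this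
   gives (2). Conversely, by Clifford the restriction to N of an irreducible
   character that is multiplicity free on N is the sum of one G-orbit on Irr(N),
   so selecting one such character per nontrivial orbit builds a pi_B contained in
   every representation in which all of Irr(G) occurs. The latter property, unlike
   being the regular representation, is inherited by Q pi, which makes the
   induction for (1) work. *)

Set Implicit Arguments.
Unset Strict Implicit.
Unset Printing Implicit Defensive.

Local Open Scope ring_scope.

(** * Constituents as embedded submodules *)

(** Bridge between characters and modules, needed because [inv_rep] is defined through fixed vectors
    rather than through its character. A constituent splits off as a direct summand; conversely
    Maschke complements the image of an embedding. *)
Lemma irr_constt_intertwinerP (gT : finGroupType) (G : {group gT})
    (r1 r : crepr G) (i : Iirr G) :
    cfRepr r1 = 'chi_i ->
  i \in irr_constt (cfRepr r) <->
  exists2 f : 'M_(rdegree r1, rdegree r),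
    row_free f & {in G, forall x, r1 x *m f = f *m r x}.
Proof.
move=> Dchi; split=> [/constt_charP | [f free_f hom_f]].
  case=> [|phi /char_reprP[r2 ->] Dr]; first exact: cfRepr_char.
  have: mx_rsim (r1 ⊕ r2) r.
    by apply/cfRepr_rsimP; rewrite cfRepr_dadd Dchi -Dr.
  case=> B /= _ free_B hom_B.
  (* [row_mx 1%:M 0] is the inclusion of the first summand in [r1 ⊕ r2]. *)
  have: row_free (row_mx 1%:M 0 *m B : 'M_(rdegree r1, _)).
    have /row_freeP[C BC1] := free_B; apply/row_freeP; exists (C *m col_mx 1%:M 0).
    by rewrite -mulmxA (mulmxA B) BC1 mul1mx mul_row_col mulmx1 mul0mx addr0.
  exists (row_mx 1%:M 0 *m B) => // x Gx.
  rewrite -[RHS]mulmxA -hom_B // !mulmxA; congr (_ *m _).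
  by rewrite mul_mx_row mulmx1 mulmx0 /dadd_grepr /= mul_row_block
             !mul1mx !mul0mx !addr0.
set U := <<f>>%MS.
have modU: mxmodule r U.
  apply/mxmoduleP=> x Gx.
  by rewrite (eqmxMr _ (genmxE f)) genmxE -hom_f // submxMl.
have [|W modW defG dxUW] :=
  mx_Maschke_pchar r (algC'G_pchar G) modU; first exact: submx1.
have sfU: (f <= U)%MS by rewrite genmxE.
have rankU: rdegree r1 = \rank U by rewrite genmxE (eqP free_f).
have rsimU: mx_rsim (submod_repr modU) r1.
  apply: mx_rsim_sym; exists (in_submod U f) => // [|x Gx].
    rewrite -[row_free _]/(\rank (in_submod U f) == rdegree r1).
    by rewrite mxrank_in_submod.
  by rewrite /= -in_submodJ // -hom_f // /in_submod mulmxA.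
pose rW := Representation (submod_repr modW).
have rsimW: mx_rsim (submod_repr modW) rW := mx_rsim_refl (submod_repr modW).
have rsim_r := mx_rsim_dadd (mxmodule1 r) defG dxUW rsimU rsimW.
have {}rsim_r: mx_rsim r (r1 ⊕ rW).
  apply: mx_rsim_trans rsim_r; apply: mx_rsim_sym; exact: rsim_submod1.
apply/constt_charP; first exact: cfRepr_char.
exists (cfRepr rW); first exact: cfRepr_char.
by rewrite (cfRepr_sim rsim_r) cfRepr_dadd Dchi.
Qed.

(** [N] acts trivially on the inflation of ['chi_i] to [G], so any embedding of it into [r] lands in
    the [N]-fixed vectors and is also an embedding over [G / N]. *)
Lemma inv_rep_constt (gT : finGroupType) (G N : {group gT}) (nsNG : N <| G)
    (r : crepr G) i :
  mod_Iirr i \in irr_constt (cfRepr r) ->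
  i \in irr_constt (cfRepr (inv_rep nsNG r)).
Proof.
have [sNG nNG] := andP nsNG.
pose r1 : crepr G := Representation (@morphim_repr _ _ _ _ _ (coset N) _ 'Chi_i nNG).
have Dr1: cfRepr r1 = 'chi_(mod_Iirr i).
  by rewrite mod_IirrE // -irrRepr cfRepr_morphim.
case/(irr_constt_intertwinerP _ Dr1) => f free_f hom_f.
have sfN: (f <= rfix_mx r N)%MS.
  apply/rfix_mxP=> x Nx.
  rewrite -hom_f ?(subsetP sNG) //= coset_id //.
  by rewrite /morphim_mx repr_mx1 mul1mx.
apply/(@irr_constt_intertwinerP _ _ (Representation 'Chi_i) _ _ (irrRepr i)).
exists (in_submod _ f) => [|_ /morphimP[x Nx Gx ->]].
  rewrite -[row_free _]/(\rank (in_submod _ f) == rdegree r1).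
  by rewrite mxrank_in_submod.
have ->: inv_rep nsNG r (coset N x)
       = submod_mx (normal_rfix_mx_module r nsNG) x by apply: quo_repr_coset.
rewrite -in_submodJ // -hom_f //.
by rewrite /in_submod mulmxA.
Qed.

Section Constituents.

Variables (gT : finGroupType) (G : {group gT}).

Lemma irr_constt_addl (phi psi : 'CF(G)) i :
    phi \is a character -> psi \is a character ->
  i \in irr_constt phi -> i \in irr_constt (phi + psi).
Proof.
move=> Nphi Npsi; rewrite !irr_consttE cfdotDl.
have /natrP[m ->] := Cnat_cfdot_char_irr i Nphi.
have /natrP[n ->] := Cnat_cfdot_char_irr i Npsi.
by rewrite -natrD !pnatr_eq0 addn_eq0 => /negPf->.
Qed.

Lemma irr_constt_dadd (r1 r2 : crepr G) i :
  i \in irr_constt (cfRepr r1) -> i \in irr_constt (cfRepr (r1 ⊕ r2)).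
Proof. by rewrite cfRepr_dadd; apply: irr_constt_addl; apply: cfRepr_char. Qed.

Lemma cfRepr_nontriv_linear_sum :
  abelian G -> cfRepr (nontriv_linear_sum G) = \sum_(i : Iirr G | i != 0) 'chi_i.
Proof.
move=> abG; rewrite /nontriv_linear_sum cfRepr_dsum.
apply: eq_big => [i | i _]; last exact: irrRepr.
by rewrite (char_abelianP _ abG).
Qed.

End Constituents.

Lemma cfdot_sum_neq0_irr (gT : finGroupType) (G : {group gT}) (j : Iirr G) :
  '[\sum_(i | i != 0) 'chi_i, 'chi_j] = (j != 0)%:R.
Proof.
rewrite cfdot_suml (eq_bigr (fun i => (i == j)%:R)) => [|i _]; last exact: cfdot_irr.
have [-> | nz_j] := eqVneq j 0.
  by apply: big1 => i /negPf->.
by rewrite (bigD1 j) //= eqxx big1 ?addr0 // => i /andP[_ /negPf->].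
Qed.

(** * From complete representations to pseudo-unramified groups *)

Lemma pseudo_unramified_of_rep (gT : finGroupType) (G N : {group gT})
    (nsNG : N <| G) (rB : crepr G) :
    abelian N -> mx_rsim (res_rep nsNG rB) (nontriv_linear_sum N) ->
  pseudo_unramified G N.
Proof.
move=> abN /cfRepr_sim; rewrite /res_rep cfRepr_sub cfRepr_nontriv_linear_sum //.
set phi := cfRepr rB => Dphi j; have Nphi: phi \is a character by apply: cfRepr_char.
have sNG := normal_sub nsNG.
(* [rB] does not see the trivial character of [N]; the trivial character of [G] serves there. *)
have [-> | nz_j] := eqVneq j 0.
  exists 0; rewrite irr0 cfRes_cfun1 // irr0 cfnorm1 ltr01; split=> // k.
  by rewrite -irr0 cfdot_irr; case: eqP.
have phi_j: j \in irr_constt ('Res[N] phi).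
  by rewrite irr_consttE Dphi cfdot_sum_neq0_irr nz_j oner_eq0.
have [i phi_i Res_i]:
    exists2 i, i \in irr_constt phi & j \in irr_constt ('Res[N] 'chi_i).
  apply/exists_inP; apply: contraLR phi_j => /exists_inPn no_i.
  rewrite irr_consttE negbK [phi]cfun_sum_constt linear_sum cfdot_suml big1 //= => i.
  move/no_i; rewrite irr_consttE negbK => /eqP Res0.
  by rewrite linearZ cfdotZl Res0 mulr0.
exists i; split=> [|k].
  by rewrite lt0r -irr_consttE Res_i natr_ge0 ?Cnat_cfdot_char_irr ?cfRes_char ?irr_char.
apply: le_trans (cfdot_Res_ge_constt k Nphi phi_i) _.
by rewrite Dphi cfdot_sum_neq0_irr lern1 leq_b1.
Qed.

Lemma complete_totally_pseudo_unramified :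
  forall (gT : finGroupType) (G : {group gT}) (r : crepr G),
    complete r -> totally_pseudo_unramified G.
Proof.
(* Recursion on the derivation of completeness itself, whose recursive occurrence sits inside a
   disjunction. *)
fix IH 4 => gT G r [rB rJ N nsNG _ ntN abN rsimB [defG | complQ]].
  by apply: TpuAbelian; rewrite defG.
apply: (TpuQuotient nsNG ntN abN); first exact: pseudo_unramified_of_rep rsimB.
exact: IH complQ.
Qed.

(** * Selecting one character of [G] per orbit on [Irr(N)] *)

Section Selection.

Variables (gT : finGroupType) (G N : {group gT}).
Hypotheses (nsNG : N <| G) (pseudoN : pseudo_unramified G N).

Let lies_over (i : Iirr G) (j : Iirr N) := j \in irr_constt ('Res[N] 'chi_i).

Let Nat_Res i j : '['Res[N] 'chi[G]_i, 'chi_j] \is a Num.nat.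
Proof. by rewrite Cnat_cfdot_char_irr ?cfRes_char ?irr_char. Qed.

(** By Clifford, [j] and [k] are [G]-conjugate, hence induce the same character of [G]; Frobenius
    reciprocity concludes. *)
Lemma lies_over_conj i i' j k :
  lies_over i j -> lies_over i k -> lies_over i' j = lies_over i' k.
Proof.
move=> ij ik; rewrite /lies_over !irr_consttE !cfdot_Res_l.
suff /cfclass_Ind->: 'chi_k \in ('chi_j ^: G)%CF by [].
apply: contraLR ik; rewrite /lies_over irr_consttE negbK.
rewrite (Clifford_Res_sum_cfclass nsNG ij) cfdotZl => notjk.
rewrite reindex_cfclass // cfdot_suml big1 ?mulr0 // => l jl.
by rewrite cfdot_irr; case: eqP notjk => // <-; rewrite jl.
Qed.

(** The trivial character of [N] is alone in its orbit: it is the only one below the trivial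
    character of [G]. *)
Lemma lies_over_neq0 i j k : lies_over i j -> lies_over i k -> j != 0 -> k != 0.
Proof.
move=> ij ik; apply: contraNneq => k0; have := lies_over_conj 0 ij ik.
rewrite k0 /lies_over irr0 cfRes_cfun1 ?normal_sub // -irr0 !constt_irr !inE.
by rewrite eqxx => ->.
Qed.

(* The predicate under [pick] depends only on the G-orbit of j, hence so does
   sel j. *)
Let sel (j : Iirr N) : Iirr G :=
  odflt 0 [pick i | lies_over i j && [forall k, '['Res[N] 'chi_i, 'chi_k] <= 1]].

Lemma sel_lies_over j : lies_over (sel j) j.
Proof.
rewrite /sel; case: pickP => [i /andP[]// | no_i].
(* Pseudo-unramifiedness excludes the default value of [sel]. *)
have [i [/lt0r_neq0 ij freei]] := pseudoN j.
have /negP[] := negbT (no_i i); rewrite /lies_over irr_consttE ij /=.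
exact/forallP.
Qed.

Lemma sel_free j k : '['Res[N] 'chi_(sel j), 'chi_k] <= 1.
Proof.
rewrite /sel; case: pickP => [i /andP[_ /forallP]// | no_i] /=.
have [i [/lt0r_neq0 ij freei]] := pseudoN j.
have /negP[] := negbT (no_i i); rewrite /lies_over irr_consttE ij /=.
exact/forallP.
Qed.

Lemma eq_sel j k : lies_over (sel j) k = (sel j == sel k).
Proof.
apply/idP/eqP => [jk | ->]; last exact: sel_lies_over.
rewrite /sel; congr (odflt 0 _); apply: eq_pick => i /=.
by rewrite (lies_over_conj i (sel_lies_over j) jk).
Qed.

Lemma cfdot_Res_sel j k : '['Res[N] 'chi_(sel j), 'chi_k] = (sel j == sel k)%:R.
Proof.
rewrite -eq_sel /lies_over irr_consttE.
have := sel_free j k; have /natrP[n ->] := Nat_Res (sel j) k.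
by rewrite lern1 pnatr_eq0; case: n => [|[]].
Qed.

(** Summing over the image of [sel], not over [j], counts each orbit once: a nontrivial [k] is met
    only by [sel k], and the trivial one by no selected character. *)
Lemma cfRes_sel :
  'Res[N] (\sum_(i in sel @: [set j | j != 0]) 'chi_i) = \sum_(j | j != 0) 'chi_j.
Proof.
rewrite [LHS]cfun_sum_cfdot [RHS]cfun_sum_cfdot; apply: eq_bigr => k _.
congr (_ *: _); rewrite cfdot_sum_neq0_irr linear_sum cfdot_suml /=.
rewrite (eq_bigr (fun i => (i == sel k)%:R)); last first.
  by move=> _ /imsetP[j _ ->]; apply: cfdot_Res_sel.
have [nz_k | z_k] := boolP (k != 0).
  rewrite (bigD1 (sel k)) ?imset_f ?inE //= eqxx big1 ?addr0 //.
  by move=> i /andP[_ /negPf->].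
rewrite big1 // => _ /imsetP[j nz_j ->]; rewrite inE in nz_j.
rewrite -eq_sel; case jk: (lies_over _ _) => //.
by rewrite (lies_over_neq0 (sel_lies_over j) jk nz_j) in z_k.
Qed.

Lemma pseudo_unramified_split (r : crepr G) :
    abelian N -> (forall i, i \in irr_constt (cfRepr r)) ->
  exists rB rJ : crepr G,
    mx_rsim r (rB ⊕ rJ) /\ mx_rsim (res_rep nsNG rB) (nontriv_linear_sum N).
Proof.
move=> abN r_all; set S := sel @: [set j | j != 0].
have /char_reprP[rB DrB]: \sum_(i in S) 'chi_i \is a character.
  by apply: rpred_sum => i _; apply: irr_char.
(* Each irreducible character is subtracted at most once and has multiplicity at least 1 in [r]. *)
have /char_reprP[rJ DrJ]: cfRepr r - \sum_(i in S) 'chi_i \is a character.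
  rewrite [cfRepr r]cfun_sum_cfdot [X in _ - X]big_mkcond -sumrB.
  apply: rpred_sum => i _; have := r_all i; rewrite irr_consttE.
  have /natrP[n ->] := Cnat_cfdot_char_irr i (cfRepr_char r).
  rewrite pnatr_eq0 -lt0n => n_gt0.
  have ->: (if i \in S then 'chi_i else 0) = (i \in S)%:R *: 'chi_i.
    by case: ifP; rewrite ?scale1r ?scale0r.
  rewrite -scalerBl -natrB ?scaler_nat ?rpredMn ?irr_char //.
  exact: leq_trans (leq_b1 _) n_gt0.
exists rB, rJ; split; apply/cfRepr_rsimP.
  by rewrite cfRepr_dadd -DrB -DrJ addrC subrK.
by rewrite cfRepr_sub -DrB cfRes_sel cfRepr_nontriv_linear_sum.
Qed.

End Selection.

(** * Building complete representations *)

(** The trivial group must be excluded: it is abelian, but has no nontrivial [N] and so no complete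
    representation. *)
Lemma totally_pseudo_unramified_complete (gT : finGroupType) (G : {group gT}) :
    totally_pseudo_unramified G -> G :!=: 1%g ->
  forall r : crepr G, (forall i, i \in irr_constt (cfRepr r)) -> complete r.
Proof.
elim=> {gT G} [gT G abG ntG r r_all | gT G N nsNG ntN abN pseudoN _ IH _ r r_all].
  have pseudoG: pseudo_unramified G G.
    move=> j; exists j; rewrite cfRes_id cfdot_irr eqxx ltr01; split=> // k.
    by rewrite cfdot_irr; case: eqP.
  have [rB [rJ [rsim_r rsimB]]] :=
    pseudo_unramified_split (normal_refl G) pseudoG abG r_all.
  by apply: (Complete rsim_r ntG abG rsimB); left.
have [rB [rJ [rsim_r rsimB]]] := pseudo_unramified_split nsNG pseudoN abN r_all.
apply: (Complete rsim_r ntN abN rsimB).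
(* The induction hypothesis requires [G / N] to be nontrivial. *)
have [-> | neqGN] := eqVneq (G : {set gT}) N; [by left | right].
apply: IH => [|i].
  rewrite -subG1 quotient_sub1 ?normal_norm //; apply: contra neqGN => sGN.
  by rewrite eqEsubset sGN normal_sub.
(* [r] is the leftmost of the five summands in [Q_rep], and already contains every inflated
   character. *)
by apply: inv_rep_constt; do 4 apply: irr_constt_dadd.
Qed.

Lemma regular_rep_constt (gT : finGroupType) (G : {group gT}) i :
  i \in irr_constt (cfRepr (regular_rep G)).
Proof.
rewrite cfReprReg irr_consttE cfReg_sum cfdot_suml (bigD1 i) //=.
rewrite cfdotZl cfdot_irr eqxx mulr1 big1 ?addr0 ?irr1_neq0 // => j /negPf ne_ji.
by rewrite cfdotZl cfdot_irr ne_ji mulr0.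
Qed.

Theorem theorem4p4 (gT : finGroupType) (G : {group gT}) :
  [/\ G :!=: 1%g -> totally_pseudo_unramified G -> complete (regular_rep G),
      (exists r : crepr G, complete r) -> totally_pseudo_unramified G
    & G :!=: 1%g ->
      (totally_pseudo_unramified G <-> exists r : crepr G, complete r)].
Proof.
have regular_complete: G :!=: 1%g -> totally_pseudo_unramified G ->
    complete (regular_rep G).
  move=> ntG tpuG; apply: totally_pseudo_unramified_complete => // i.
  exact: regular_rep_constt.
have complete_tpu: (exists r : crepr G, complete r) -> totally_pseudo_unramified G.
  by case=> r; apply: complete_totally_pseudo_unramified.
split=> // ntG; split=> // tpuG; exists (regular_rep G); exact: regular_complete.
Qed.
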